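(* Let $h:\Sigma^n\to\Sigma$ be an $n$-quasigroup, let $\Sigma=\{a,b,c,d\}$, and let $Q$ be the set of all $n$-quasigroups $f$ such that $f(\bar x)=h(\bar x)$ for every $\bar x=(x_1,\ldots,x_n)\in\Sigma^n$ with $x_n\in\{a,b\}$. If $2<|Q|<2^{2^{n-1}}$, then $h$ is reducible. If $|Q|=2^{2^{n-1}}$, then $h$ is semilinear.
   Context: Let $\Sigma=\{0,1,2,3\}$, $[n]=\{1,\ldots,n\}$. An $n$-quasigroup is a map $g:\Sigma^n\to\Sigma$ such that, for each $i$ and each fixing of the other arguments, $x_i\mapsto g(\bar x)$ is a bijection of $\Sigma$. For $K=\{i_1<\cdots<i_m\}\subseteq[n]$, $\bar x_K=(x_{i_1},\ldots,x_{i_m})$. An $n$-quasigroup $g$ is reducible if there exist $k'$ with $2\le k'\le n-1$, a partition $\{L_1,\ldots,L_{k'}\}$ of $[n]$ into nonempty sets, a $k'$-quasigroup $f_0$ and $|L_j|$-quasigroups $f_j$ with $g(\bar x)=f_0(f_1(\bar x_{L_1}),\ldots,f_{k'}(\bar x_{L_{k'}}))$. An $i$-line of $\Sigma^m$ is a set of four words agreeing except in coordinate $i$. An MDS code in $\Sigma^m$ is a set meeting every line in exactly one element; a double-MDS-code is a set meeting every line in exactly two elements; a double-MDS-code $D\subseteq\Sigma^m$ is linear if its characteristic function satisfies $\chi_D(y_1,\ldots,y_m)=\chi_1(y_1)\oplus\cdots\oplus\chi_m(y_m)$ (mod 2) for some $\chi_i:\Sigma\to\{0,1\}$; an MDS code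 is semilinear if contained in a linear double-MDS-code; an $n$-quasigroup $g$ is semilinear if $\{(\bar x,g(\bar x)):\bar x\in\Sigma^n\}\subseteq\Sigma^{n+1}$ is semilinear. *)

(* Defs.v *)
From mathcomp Require Import all_boot.
Set Warnings "-notation-overridden".
Set Implicit Arguments. Unset Strict Implicit. Unset Printing Implicit Defensive.

Notation Sigma := 'I_4.

Notation word m := {ffun 'I_m -> Sigma}.

Definition upd (m : nat) (x : word m) (i : 'I_m) (y : Sigma) : word m :=
  [ffun j => if j == i then y else x j].

Definition bijb (F : Sigma -> Sigma) : bool :=
  [exists G : {ffun Sigma -> Sigma},
     [forall y, G (F y) == y] && [forall y, F (G y) == y]].

Definition is_quasigroup (m : nat) (g : word m -> Sigma) : bool :=
  [forall i : 'I_m, forall x : word m, bijb (fun y => g (upd x i y))].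

(* x_L = (x_{i_1},...,x_{i_k}) with i_1 < ... < i_k the elements of L
   (enum of a subset of 'I_m lists its elements in increasing order). *)
Definition restr (m : nat) (x : word m) (L : {set 'I_m}) : word #|L| :=
  [ffun t => x (enum_val t)].

Definition reducible (n : nat) (g : word n -> Sigma) : Prop :=
  exists (k : nat) (L : 'I_k -> {set 'I_n}) (f0 : word k -> Sigma)
         (fs : forall j : 'I_k, word #|L j| -> Sigma),
    (2 <= k <= n - 1) /\
    (forall j, L j != set0) /\
    (forall j1 j2, j1 != j2 -> [disjoint L j1 & L j2]) /\
    \bigcup_(j < k) L j = [set: 'I_n] /\
    is_quasigroup f0 /\
    (forall j, is_quasigroup (fs j)) /\
    (forall x, g x = f0 [ffun j => fs j (restr x (L j))]).

Definition line (m : nat) (i : 'I_m) (y : word m) : {set word m} :=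
  [set z : word m | [forall j, (j != i) ==> (z j == y j)]].

Definition MDS_code (m : nat) (C : {set word m}) : Prop :=
  forall i y, #|line i y :&: C| = 1.

Definition double_MDS_code (m : nat) (D : {set word m}) : Prop :=
  forall i y, #|line i y :&: D| = 2.

Definition linear_double_MDS (m : nat) (D : {set word m}) : Prop :=
  double_MDS_code D /\
  exists chi : 'I_m -> Sigma -> bool,
    forall y, (y \in D) = \big[addb/false]_(i < m) chi i (y i).

Definition semilinear_code (m : nat) (C : {set word m}) : Prop :=
  MDS_code C /\ exists D, linear_double_MDS D /\ C \subset D.

Definition graph (n : nat) (g : word n -> Sigma) : {set word n.+1} :=
  [set y : word n.+1 | y ord_max == g [ffun i : 'I_n => y (widen_ord (leqnSn n) i)]].

Definition semilinear_qg (n : nat) (g : word n -> Sigma) : Prop :=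
  semilinear_code (graph g).

Definition Qset (n : nat) (h : word n -> Sigma) (a b : Sigma)
  : {set {ffun word n -> Sigma}} :=
  [set f : {ffun word n -> Sigma} | is_quasigroup f &&
     [forall x : word n,
        [exists i : 'I_n, (i.+1 == n) && (x i \in [:: a; b])] ==> (f x == h x)]].

(* Main.v *)
Require Import Defs.
From mathcomp Require Import all_boot.
Set Implicit Arguments. Unset Strict Implicit. Unset Printing Implicit Defensive.

(** In the graph of [h], let [D] be the set of pairs (x_1, ..., x_{n-1}, y) such
    that [y] is the value at some x_n outside {a, b}.  This is a double-MDS-code,
    and so is its complement.  Join two words that differ in one coordinate and lie
    on the same side of [D].  Two elements of [Q] differ by a union of components
    of [D], so |Q| is governed by the number of components.

    Among the faces (obtained by fixing all coordinates outside a set [K]) on which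
    both sides of [D] are connected, take one with |K| maximal.  A neighbouring face
    must cut [D] in the same pattern or in the complementary one, since otherwise
    both faces would lie in a larger connected face.  Hence the characteristic
    function of [D] splits as f(x_K) + g(x_{K^c}).
    - If |K| = 1, the same holds for every singleton, so [D] is linear; then [h] is
      semilinear and every one of the 2^(n-1) classes can be switched independently.
    - If |K| >= 2, every component has at least 2^(n+1) elements, so
      |Q| < 2^2^(n-1); if [K] is everything, |Q| <= 2.  Otherwise the unique
      2-colourings of the connected faces form a |K|-ary quasigroup through which
      [h] factors. *)

(** * Induction along paths, and predicates that hold for exactly two symbols *)

Lemma connect_invariant (T : finType) (e : rel T) (P : T -> Prop) (x y : T) :
  (forall u v, P u -> e u v -> P v) -> connect e x y -> P x -> P y.
Proof.
move=> PS /connectP[p]; elim: p x => [|z p IH] x /=; first by move=> _ ->.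
by case/andP=> xz zp ylast /PS-/(_ _ xz); apply: IH.
Qed.

Section BalancedPredicates.

Implicit Types p q : Sigma -> bool.

Lemma balanced_card p b : #|[set s | p s]| = 2 -> #|[set s | p s == b]| = 2.
Proof.
case: b => hp.
  by rewrite -[RHS]hp; apply: eq_card => s; rewrite !inE eqb_id.
have -> : [set s | p s == false] = ~: [set s | p s].
  by apply/setP => s; rewrite !inE eqbF_neg.
by have := cardsC [set s | p s]; rewrite hp card_ord => -[].
Qed.

Lemma balanced_ex p b : #|[set s | p s]| = 2 -> exists s, p s = b.
Proof.
move=> /(balanced_card b) hp.
have /card_gt0P[s] : 0 < #|[set s | p s == b]| by rewrite hp.
by rewrite inE => /eqP; exists s.
Qed.

Lemma balanced_sub p q b c :
  #|[set s | p s]| = 2 -> #|[set s | q s]| = 2 ->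
  (forall s, q s = b -> p s = c) -> forall s, (q s == b) = (p s == c).
Proof.
move=> /(balanced_card c) hp /(balanced_card b) hq sub s.
have /setP/(_ s) : [set s | q s == b] = [set s | p s == c].
  apply/eqP; rewrite eqEcard hp hq leqnn andbT; apply/subsetP => t.
  by rewrite !inE => /eqP/sub->.
by rewrite !inE.
Qed.

(** Otherwise [q] keeps its value wherever [p] flips. Both sets have two elements, so they coincide,
    yet [s] lies in only one of them. *)
Lemma balanced_flip p q s :
  #|[set s | p s]| = 2 -> #|[set s | q s]| = 2 -> p s != q s ->
  exists t, p t = ~~ p s /\ q t = ~~ q s.
Proof.
move=> hp hq ne.
case: (boolP [exists t, (p t == ~~ p s) && (q t == ~~ q s)]).
  by case/existsP=> t /andP[/eqP h1 /eqP h2]; exists t.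
rewrite negb_exists => /forallP no.
have /(balanced_sub hq hp)/(_ s) : forall t, p t = ~~ p s -> q t = q s.
  by move=> t pt; have := no t; rewrite pt eqxx /=; case: (q t) (q s) => [] [].
by move: ne; case: (p s) (q s) => [] [].
Qed.

Lemma balanced_third p s t r :
  #|[set s | p s]| = 2 -> p t = p s -> p r = p s -> s != t -> s != r -> t = r.
Proof.
move=> /(balanced_card (p s)) hp pt pr st sr; apply/eqP; apply: contraT => tr.
have : #|s |: (t |: [set r])| <= 2.
  rewrite -[leqRHS]hp; apply: subset_leq_card; apply/subsetP => u.
  by rewrite !inE => /or3P[]/eqP->; rewrite ?pt ?pr.
by rewrite !cardsU1 cards1 !inE (negPf st) (negPf sr) (negPf tr).
Qed.

End BalancedPredicates.

(** * Words, single-coordinate changes and mixtures of two words *)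

Section Words.

Variable n : nat.
Implicit Types (x y z v w : word n) (i j : 'I_n) (K S : {set 'I_n}).

Lemma upd_eq x i s : upd x i s i = s.
Proof. by rewrite ffunE eqxx. Qed.

Lemma upd_neq x i j s : j != i -> upd x i s j = x j.
Proof. by rewrite ffunE => /negPf->. Qed.

Lemma upd_id x i : upd x i (x i) = x.
Proof. by apply/ffunP => j; rewrite ffunE; case: eqP => [->|]. Qed.

Lemma upd_upd x i s t : upd (upd x i s) i t = upd x i t.
Proof. by apply/ffunP => j; rewrite !ffunE; case: eqP. Qed.

Lemma updC x i j s t : i != j -> upd (upd x i s) j t = upd (upd x j t) i s.
Proof.
move=> ij; apply/ffunP => k; rewrite !ffunE.
by case: eqP => // ->; rewrite eq_sym (negPf ij).
Qed.

Lemma upd_inj x i : injective (upd x i).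
Proof. by move=> s t /ffunP/(_ i); rewrite !upd_eq. Qed.

(** Induction on the number of coordinates in which the current word still differs from [y]. *)
Lemma word_upd_ind (P : word n -> Prop) x :
  (forall w i s, P w -> P (upd w i s)) -> P x -> forall y, P y.
Proof.
move=> PS Px y.
have [m] := ubnP #|[set j | x j != y j]|; elim: m x Px => // m IH x Px.
case: (set_0Vmem [set j | x j != y j]) => [e0 _|[j jx]].
  suff <- : x = y by [].
  apply/ffunP => j; apply/eqP; apply: contraT => xy.
  by have := in_set0 j; rewrite -e0 inE xy.
rewrite ltnS => lem; apply: (IH _ (PS _ j (y j) Px)).
apply: leq_trans lem; apply: proper_card; apply/properP; split.
  apply/subsetP => k; rewrite !inE ffunE; case: (k =P j) => [->|] //.
  by rewrite eqxx.
by exists j => //; rewrite !inE upd_eq eqxx.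
Qed.

(** For fixed [v], the words [mix K x v] run over the face through [v] with free coordinates [K].
    The same [x] names corresponding points of different faces. *)
Definition mix K x v : word n := [ffun i => if i \in K then x i else v i].

Lemma mixxx K x : mix K x x = x.
Proof. by apply/ffunP => i; rewrite ffunE if_same. Qed.

Lemma mix_mixl K x v w : mix K (mix K x v) w = mix K x w.
Proof. by apply/ffunP => i; rewrite !ffunE; case: (i \in K). Qed.

Lemma mix_setT x v : mix setT x v = x.
Proof. by apply/ffunP => i; rewrite ffunE inE. Qed.

Lemma mix_set1 i x v : mix [set i] x v = upd v i (x i).
Proof. by apply/ffunP => j; rewrite !ffunE inE; case: eqP => [->|]. Qed.

Lemma mix_setU1 K j x v : j \notin K -> mix (j |: K) x v = mix K x (upd v j (x j)).
Proof.
move=> jK; apply/ffunP => i; rewrite !ffunE in_setU1.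
by case: eqP => [->|] //=; rewrite (negPf jK).
Qed.

Lemma upd_mix_in K i x v s : i \in K -> upd (mix K x v) i s = mix K (upd x i s) v.
Proof. by move=> iK; apply/ffunP => j; rewrite !ffunE; case: eqP => // ->; rewrite iK. Qed.

Lemma upd_mix_notin K i x v s :
  i \notin K -> upd (mix K x v) i s = mix K x (upd v i s).
Proof.
move=> iK; apply/ffunP => j; rewrite !ffunE.
by case: eqP => // ->; rewrite (negPf iK).
Qed.

Lemma mix_upd_in K i x v s : i \in K -> mix K x (upd v i s) = mix K x v.
Proof.
move=> iK; apply/ffunP => j; rewrite !ffunE.
by case: ifP => // jK; case: eqP => // ji; rewrite ji iK in jK.
Qed.

End Words.

(** * Connected faces of a double-MDS-code and their maximality *)

Section Faces.

Variables (n : nat) (chi : word n -> bool).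
Hypothesis chi_bal : forall x i, #|[set s | chi (upd x i s)]| = 2.
Implicit Types (x y z v w : word n) (i j : 'I_n) (K S : {set 'I_n}).

Definition adj K : rel (word n) :=
  fun x y => (chi x == chi y) && [exists i in K, y == upd x i (y i)].

Definition face_conn K v : bool :=
  [forall x, forall y, (chi (mix K x v) == chi (mix K y v)) ==>
     connect (adj K) (mix K x v) (mix K y v)].

(** Equal differences mean that the two faces carry equal or complementary patterns. *)
Definition parallel K v w : Prop :=
  forall x y, chi (mix K x v) (+) chi (mix K y v) =
              chi (mix K x w) (+) chi (mix K y w).

Lemma face_connP K v :
  reflect (forall x y, chi (mix K x v) = chi (mix K y v) ->
             connect (adj K) (mix K x v) (mix K y v)) (face_conn K v).
Proof.
apply: (iffP 'forall_forallP) => H x y.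
  by move=> e; apply: (implyP (H x y)); rewrite e.
by apply/implyP => /eqP; apply: H.
Qed.

Lemma adj_upd K x i s : i \in K -> chi x = chi (upd x i s) -> adj K x (upd x i s).
Proof.
move=> iK e; rewrite /adj e eqxx /=; apply/existsP; exists i.
by rewrite iK upd_eq eqxx.
Qed.

Lemma adjP K x y : adj K x y ->
  chi x = chi y /\ exists i s, i \in K /\ y = upd x i s.
Proof.
case/andP=> /eqP e /existsP[i /andP[iK /eqP h]].
by split=> //; exists i, (y i).
Qed.

Lemma adj_sym K : symmetric (adj K).
Proof.
suff sub x y : adj K x y -> adj K y x by move=> x y; apply/idP/idP; apply: sub.
case/adjP=> e [i [s [iK def]]].
have def' : x = upd y i (x i) by rewrite def upd_upd upd_id.
by rewrite def'; apply: adj_upd => //; rewrite -def'.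
Qed.

Lemma adj_connect_sym K : connect_sym (adj K).
Proof. exact/sym_connect_sym/adj_sym. Qed.

Lemma adj_connect_sub K S x y :
  K \subset S -> connect (adj K) x y -> connect (adj S) x y.
Proof.
move=> /subsetP KS; apply: connect_sub => u v /adjP[e [i [s [iK def]]]].
by apply: connect1; rewrite def; apply: adj_upd; rewrite -?def ?KS.
Qed.

Lemma connect_chi K x y : connect (adj K) x y -> chi x = chi y.
Proof.
move=> /(connect_invariant (P := fun z => chi x = chi z)); apply => //.
by move=> u v -> /adjP[].
Qed.

Lemma face_conn_set1 i v : face_conn [set i] v.
Proof.
apply/face_connP => x y; rewrite !mix_set1 => e; apply: connect1.
by rewrite -(upd_upd v i (x i) (y i)); apply: adj_upd; rewrite ?inE ?upd_upd.
Qed.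

Lemma mix_face K x v i s :
  i \in K -> mix K x v = x -> mix K (upd x i s) v = upd x i s.
Proof. by move=> iK {2}<-; rewrite upd_mix_in. Qed.

(** A path is copied step by step: a step keeps the colour in one face exactly when it does in the
    other. *)
Lemma parallel_conn K v w : parallel K v w -> face_conn K v -> face_conn K w.
Proof.
move=> par /face_connP conn; apply/face_connP => x y e.
have /conn c : chi (mix K x v) = chi (mix K y v).
  by move: (par x y); rewrite e addbb; do 2 case: chi.
pose P u := mix K u v = u /\ connect (adj K) (mix K x w) (mix K u w).
have: P (mix K y v).
  apply: (connect_invariant _ c); last by split; rewrite mix_mixl.
  move=> u u' [fu cu] /adjP[eu [i [s [iK def]]]]; split.
    by rewrite def mix_face.
  apply: connect_trans cu _; apply: connect1.
  rewrite def -upd_mix_in //; apply: adj_upd => //.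
  rewrite upd_mix_in // -def; move: (par u u').
  by rewrite fu (_ : mix K u' v = u') -?eu ?addbb; [do 2 case: chi | rewrite def mix_face].
by case=> _; rewrite mix_mixl.
Qed.

(** If the second alternative fails, some component of layer [c] lies entirely over points of the
    opposite colour. Walking in the connected base face shows that it covers that whole colour
    class, and a count on lines then makes the two layers complementary. *)
Lemma layer_dichotomy K j v c :
  K != set0 -> j \notin K -> face_conn K v ->
  (forall x, chi (mix K x (upd v j c)) = ~~ chi (mix K x v)) \/
  (forall x, exists z, connect (adj K) (mix K x (upd v j c)) (mix K z (upd v j c))
                /\ chi (mix K z (upd v j c)) = chi (mix K z v)).
Proof.
move=> /set0Pn[i0 i0K] jK /face_connP conn; set vc := upd v j c.
case: (boolP [forall x, exists z, connect (adj K) (mix K x vc) (mix K z vc) &&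
                 (chi (mix K z vc) == chi (mix K z v))]) => [/forallP H|].
  right=> x; have /existsP[z /andP[h1 /eqP h2]] := H x.
  by exists z.
rewrite negb_forall => /existsP[x]; rewrite negb_exists => /forallP no.
left; set b := chi (mix K x vc).
have X z : connect (adj K) (mix K x vc) (mix K z vc) -> chi (mix K z v) = ~~ b.
  move=> cz; have := no z; rewrite cz -(connect_chi cz) -/b /=.
  by case: (b); case: chi.
(* The component follows any path of colour [~~ b] in the base face. *)
have closedX z : chi (mix K z v) = ~~ b -> connect (adj K) (mix K x vc) (mix K z vc).
  move=> ez.
  have /conn cz : chi (mix K x v) = chi (mix K z v).
    by rewrite ez X.
  pose P u := mix K u v = u /\ connect (adj K) (mix K x vc) (mix K u vc).
  have: P (mix K z v).
    apply: (connect_invariant _ cz); last by split; rewrite mix_mixl.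
    move=> u u' [fu cu] /adjP[eu [i [s [iK def]]]]; split.
      by rewrite def mix_face.
    apply: connect_trans (cu) _; apply: connect1.
    (* The two symbols of colour [b] on this line belong to the component, hence lie over colour
       [~~ b]; only two symbols have that colour below, so the converse holds too. *)
    have line t : chi (upd (mix K u vc) i t) = b -> chi (upd u i t) = ~~ b.
      move=> et; rewrite -{1}fu upd_mix_in //; apply: X.
      apply: connect_trans (cu) _; apply: connect1.
      by rewrite -upd_mix_in //; apply: adj_upd; rewrite // et -(connect_chi cu).
    have := balanced_sub (chi_bal u i) (chi_bal (mix K u vc) i) line s.
    have eub : chi u = ~~ b by rewrite -fu X.
    rewrite -def -eu eub eqxx => /eqP e1.
    by rewrite def -upd_mix_in //; apply: adj_upd; rewrite // e1 -(connect_chi cu).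
  by case=> _; rewrite mix_mixl.
move=> z.
have line t : chi (upd (mix K z v) i0 t) = ~~ b -> chi (upd (mix K z vc) i0 t) = b.
  by rewrite !upd_mix_in // => /closedX/connect_chi <-.
have := balanced_sub (chi_bal _ _) (chi_bal _ _) line (z i0).
rewrite !upd_mix_in // upd_id.
by do 2 case: chi; case: (b).
Qed.

(** By contraposition: if layer [c1] is neither equal nor complementary to the base face, every
    layer can be linked to the base face inside [j |: K], which makes the larger face connected. *)
Lemma face_conn_step K j v :
  K != set0 -> j \notin K -> face_conn K v -> ~~ face_conn (j |: K) v ->
  forall c, parallel K v (upd v j c).
Proof.
move=> K0 jK conn nconn c1 x1 y1; apply/eqP; apply: contraNT nconn => ne.
have [i iK] := set0Pn _ K0.
have [x0 nx0] : exists x0, chi (mix K x0 v) != chi (mix K x0 (upd v j c1)).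
  case: (eqVneq (chi (mix K x1 v)) (chi (mix K x1 (upd v j c1)))); last by exists x1.
  by move=> e; exists y1; apply: contraNneq ne => e'; rewrite e e'.
(* Layer [c1] contains points of either colour that disagree with the base: [x0] is one, and
   flipping both colours on a line through it gives the other. *)
have split_pt b : exists z, chi (mix K z (upd v j c1)) = b /\ chi (mix K z v) = ~~ b.
  case: (eqVneq (chi (mix K x0 (upd v j c1))) b) => [eb|nb].
    by exists x0; split=> //; move: nx0; rewrite eb; case: chi; case: (b).
  have := @balanced_flip (fun s => chi (upd (mix K x0 v) i s))
    (fun s => chi (upd (mix K x0 (upd v j c1)) i s)) (x0 i) (chi_bal _ _) (chi_bal _ _).
  rewrite !upd_mix_in // !upd_id => /(_ nx0)[t]; rewrite !upd_mix_in // => -[e1 e2].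
  exists (upd x0 i t); rewrite e1 e2; split.
    by move: nb; case: chi; case: (b).
  by move: nx0 nb; do 2 case: chi; case: (b).
have sub := adj_connect_sub (subsetU1 j K).
have jump x s t : chi (mix K x (upd v j s)) = chi (mix K x (upd v j t)) ->
    connect (adj (j |: K)) (mix K x (upd v j s)) (mix K x (upd v j t)).
  move=> e; apply: connect1.
  rewrite -(upd_upd v j s t) -(upd_mix_notin x (upd v j s) t jK); apply: adj_upd.
    by rewrite setU11.
  by rewrite upd_mix_notin // upd_upd.
have good c x : (exists z, connect (adj K) (mix K x (upd v j c)) (mix K z (upd v j c))
                /\ chi (mix K z (upd v j c)) = chi (mix K z v)) ->
    exists z, connect (adj (j |: K)) (mix K x (upd v j c)) (mix K z v).
  case=> z [/sub cz ez]; exists z; apply: connect_trans cz _.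
  by move: (jump z c (v j)); rewrite upd_id; apply.
have good1 x : exists z, connect (adj (j |: K)) (mix K x (upd v j c1)) (mix K z v).
  case: (layer_dichotomy c1 K0 jK conn) => [anti|]; last by move/(_ x)/good.
  by case/negP: ne; rewrite !anti; do 2 case: chi.
have reach c x : exists z, connect (adj (j |: K)) (mix K x (upd v j c)) (mix K z v).
  case: (layer_dichotomy c K0 jK conn) => [anti|]; last by move/(_ x)/good.
  (* A complementary layer [c] has no direct jump to the base face. At [z] the layers [c] and [c1]
     agree, so the route passes through [c1]. *)
  have [z [e1 e2]] := split_pt (chi (mix K x (upd v j c))).
  have ez : chi (mix K z (upd v j c)) = chi (mix K x (upd v j c)).
    by rewrite anti e2 negbK.
  have [y cy] := good1 z; exists y; apply: connect_trans cy.
  apply: (@connect_trans _ _ (mix K z (upd v j c))); last by apply: jump; rewrite e1.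
  apply: sub; have /parallel_conn/(_ conn)/face_connP : parallel K v (upd v j c).
    by move=> p q; rewrite !anti; do 2 case: chi.
  by apply.
apply/face_connP => x y; rewrite !mix_setU1 // => e.
have [x' cx] := reach (x j) x; have [y' cy] := reach (y j) y.
apply: connect_trans (cx) _; rewrite adj_connect_sym.
apply: connect_trans (cy) _.
apply: sub; apply: (face_connP _ _ conn).
by rewrite -(connect_chi cx) -(connect_chi cy).
Qed.

(** Coordinates are changed one at a time: one in [K] leaves the face unchanged, and one outside [K]
    gives a parallel face, as maximality forbids [j |: K] to be connected. *)
Lemma maximal_face_conn K v0 :
  K != set0 -> face_conn K v0 ->
  (forall S v, face_conn S v -> #|S| <= #|K|) ->
  forall v, face_conn K v /\ parallel K v0 v.
Proof.
move=> K0 conn0 maxK; apply: (@word_upd_ind _ _ v0); last by split.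
move=> w j s [conn par]; case: (boolP (j \in K)) => jK.
  split; last by move=> x y; rewrite !mix_upd_in.
  apply: parallel_conn conn => x y; rewrite !mix_upd_in //.
have nconn : ~~ face_conn (j |: K) w.
  by apply/negP => /maxK; rewrite cardsU1 jK ltnn.
have stp := face_conn_step K0 jK conn nconn s.
by split; [apply: parallel_conn conn | move=> x y; rewrite par stp].
Qed.

End Faces.

(** * Quasigroups and a sufficient condition for reducibility *)

Lemma quasigroupP m (g : word m -> Sigma) :
  reflect (forall i x, injective (fun s => g (upd x i s))) (is_quasigroup g).
Proof.
apply: (iffP 'forall_forallP) => H i x.
  have /existsP[G /andP[/forallP GF _]] := H i x.
  by apply: (can_inj (g := G)) => y; apply/eqP/GF.
have inj := H i x; apply/existsP; exists [ffun y => invF inj y].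
by apply/andP; split; apply/forallP => y; rewrite ffunE ?(invF_f inj) ?(f_invF inj).
Qed.

Lemma quasigroup_solve m (g : word m -> Sigma) i x s :
  is_quasigroup g -> exists t, g (upd x i t) = s.
Proof.
by move=> /quasigroupP/(_ i x) inj; exists (invF inj s); apply: (f_invF inj).
Qed.

Section Reducibility.

Variable n : nat.
Implicit Types (x y v w : word n) (S : {set 'I_n}).

(** A section of [restr], with [v] as default outside [S]. *)
Definition extend S v (u : word #|S|) : word n :=
  [ffun i => if [pick t | enum_val t == i] is Some t then u t else v i].

Lemma extend_enum_val S v (u : word #|S|) t : extend v u (enum_val t) = u t.
Proof.
rewrite ffunE; case: pickP => [t' /eqP/enum_val_inj-> //|/(_ t)].
by rewrite eqxx.
Qed.

Lemma extend_out S v (u : word #|S|) i : i \notin S -> extend v u i = v i.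
Proof.
rewrite ffunE; case: pickP => [t /eqP <-|//].
by rewrite (enum_valP t).
Qed.

Lemma extend_restr S v x : extend v (restr x S) = mix S x v.
Proof.
apply/ffunP => i; rewrite [RHS]ffunE; case: ifP => [iS|/negbT/extend_out//].
by rewrite -(enum_rankK_in iS iS) extend_enum_val ffunE.
Qed.

Lemma extend_upd S v (u : word #|S|) t s :
  extend v (upd u t s) = upd (extend v u) (enum_val t) s.
Proof.
apply/ffunP => i; rewrite [RHS]ffunE.
case: (boolP (i \in S)) => iS; last first.
  rewrite !extend_out //; case: eqP => // e.
  by rewrite e (enum_valP t) in iS.
rewrite -(enum_rankK_in iS iS) !extend_enum_val ffunE.
by rewrite (inj_eq enum_val_inj).
Qed.

(** By the congruence, the value of [g] with [v0] outside [S] tells all that matters about the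
    coordinates in [S]. This value is the inner quasigroup; the outer one replaces a value [s] by
    the representative [U s] and takes the other coordinates unchanged. *)
Lemma reducible_of_congruence (g : word n -> Sigma) S :
  is_quasigroup g -> 2 <= #|S| < n ->
  (forall x y v w, g (mix S x v) = g (mix S y v) ->
                   g (mix S x w) = g (mix S y w)) ->
  reducible g.
Proof.
move=> gq /andP[S2 Sn] cong.
have gqP := quasigroupP _ gq.
pose v0 : word n := [ffun=> ord0].
have [i0 i0S] : exists i, i \in S by apply/card_gt0P; apply: leq_trans S2.
pose U s : word n := upd v0 i0 (invF (gqP i0 v0) s).
have gU s : g (mix S (U s) v0) = s.
  by rewrite /U -upd_mix_in // mixxx; apply: (f_invF (gqP i0 v0)).
(* Index [ord0] stands for the block [S], the others for singletons; the bounds on [#|S|] become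
   those on [k]. *)
pose k := #|~: S|.+1.
pose L (j : 'I_k) : {set 'I_n} :=
  if unlift ord0 j is Some t then [set enum_val t] else S.
pose F (j : 'I_k) : word n -> Sigma :=
  if unlift ord0 j is Some t then fun z => z (enum_val t) else g.
pose V (w : word k) : word n := extend v0 [ffun t : 'I_#|~: S| => w (lift ord0 t)].
pose f0 (w : word k) := g (mix S (U (w ord0)) (V w)).
have kS : k + #|S| = n.+1 by rewrite /k addSn addnC cardsC card_ord.
exists k, L, f0, (fun j u => F j (extend v0 u)); split; last split; last split;
  last split; last split; last split.
- apply/andP; split.
    by rewrite -(ltn_add2r #|S|) kS add1n ltnS.
  rewrite subn1 -ltnS prednK; last exact: leq_ltn_trans Sn.
  by rewrite -(ltn_add2r #|S|) kS -addn1 ltn_add2l.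
- move=> j; rewrite /L; case: unliftP => [t _|_]; apply/set0Pn.
    by exists (enum_val t); rewrite inE.
  by exists i0.
- have disj (t : 'I_#|~: S|) : [disjoint [set enum_val t] & S].
    by rewrite disjoints1; have := enum_valP t; rewrite inE.
  move=> j1 j2; rewrite /L; case: unliftP => [t1 ->|->]; case: unliftP => [t2 ->|->] ne.
  + by rewrite disjoints1 inE (inj_eq enum_val_inj); apply: contraNneq ne => ->.
  + exact: disj.
  + by rewrite disjoint_sym; apply: disj.
  + by rewrite eqxx in ne.
- apply/setP => i; rewrite [RHS]inE; apply/bigcupP.
  case: (boolP (i \in S)) => iS; first by exists ord0 => //; rewrite /L unlift_none.
  have iS' : i \in ~: S by rewrite inE.
  exists (lift ord0 (enum_rank_in iS' i)) => //.
  by rewrite /L liftK inE (enum_rankK_in iS' iS').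
- apply/quasigroupP => j w s t; rewrite /f0 /V.
  case: (unliftP ord0 j) => [r ->|->].
    rewrite !upd_neq ?neq_lift //.
    have Vr c : [ffun t : 'I_#|~: S| => upd w (lift ord0 r) c (lift ord0 t)] =
        upd [ffun t : 'I_#|~: S| => w (lift ord0 t)] r c.
      by apply/ffunP => q; rewrite !ffunE (inj_eq lift_inj).
    have rS : enum_val r \notin S by have := enum_valP r; rewrite inE.
    by rewrite !Vr !extend_upd -!upd_mix_notin //; apply: gqP.
  have V0 c : [ffun t : 'I_#|~: S| => upd w ord0 c (lift ord0 t)] =
      [ffun t : 'I_#|~: S| => w (lift ord0 t)].
    by apply/ffunP => q; rewrite !ffunE eq_sym (negPf (neq_lift _ _)).
  (* In the block coordinate, the congruence moves an equality of values to [v0], where [gU] reads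
     off the symbols. *)
  by rewrite !V0 !upd_eq => e; have := cong _ _ _ v0 e; rewrite !gU.
- move=> j; apply/quasigroupP => r u s t; rewrite !extend_upd.
  move: (enum_valP r) (extend v0 u); move: (enum_val r) => {r u} i + z.
  rewrite /F /L; case: unliftP => [q _|_].
    by rewrite inE => /eqP->; rewrite !upd_eq.
  by move=> _; apply: gqP.
- move=> x; rewrite /f0.
  have -> : V [ffun j => F j (extend v0 (restr x (L j)))] = mix (~: S) x v0.
    rewrite -extend_restr /V; congr extend; apply/ffunP => t.
    rewrite !ffunE extend_restr /F /L.
    by rewrite liftK ffunE inE eqxx.
  rewrite ffunE extend_restr /F /L unlift_none.
  have -> : mix S (U (g (mix S x v0))) (mix (~: S) x v0) = mix S (U (g (mix S x v0))) x.
    by apply/ffunP => i; rewrite !ffunE inE; case: (i \in S).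
  by rewrite -{1}(mixxx S x); apply: (cong _ _ v0); rewrite gU.
Qed.

End Reducibility.

(** * The double-MDS-code determined by [a] and [b] *)

Section Cut.

Variables (n : nat) (a b : Sigma).
Implicit Types (h : word n.+1 -> Sigma) (x y z v w : word n.+1) (K : {set 'I_n.+1}).
Hypothesis ab : a != b.

Let last := @ord_max n.

(* [z] stands for (x_1, ..., x_{n-1}, y): its last coordinate holds a value of [h],
   and [s] is the n-th argument. *)
Definition hits h (s : Sigma) z : bool := h (upd z last s) == z last.

Definition cut h z : bool := ~~ hits h a z && ~~ hits h b z.

Definition free (s : Sigma) : bool := s \notin [:: a; b].

Lemma hits_upd_last h s x : hits h s (upd x last (h (upd x last s))).
Proof. by rewrite /hits upd_upd upd_eq. Qed.

Lemma free_balanced : #|[set s | free s]| = 2.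
Proof.
have -> : [set s | free s] = ~: [set a; b].
  by apply/setP => s; rewrite !inE /free !inE.
by have := cardsC [set a; b]; rewrite cards2 ab card_ord => -[].
Qed.

Section Fixed.

Variable h : word n.+1 -> Sigma.
Hypothesis hq : is_quasigroup h.

(** With [hits_line_inj]: for each [s], the words hit by [s] form an MDS code. By [hits_ex] and
    [hits_inj] these four codes partition all words. *)
Lemma hits_line_ex s z i : exists t, hits h s (upd z i t).
Proof.
case: (eqVneq i last) => [->|il].
  by exists (h (upd z last s)); apply: hits_upd_last.
have [t et] := quasigroup_solve i (upd z last s) (z last) hq.
by exists t; rewrite /hits updC // et upd_neq // eq_sym.
Qed.

Lemma hits_line_inj s z i t r :
  hits h s (upd z i t) -> hits h s (upd z i r) -> t = r.
Proof.
rewrite /hits; case: (eqVneq i last) => [->|il].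
  by rewrite !upd_upd !upd_eq => /eqP<- /eqP.
rewrite !(updC _ _ _ il) !(@upd_neq _ _ i last) 1?[last == i]eq_sym //.
by move=> /eqP e1 /eqP e2; apply: (quasigroupP _ hq i (upd z last s)); rewrite e1 e2.
Qed.

Lemma hits_ex z : exists s, hits h s z.
Proof.
by have [t et] := quasigroup_solve last z (z last) hq; exists t; apply/eqP.
Qed.

Lemma hits_inj s t z : hits h s z -> hits h t z -> s = t.
Proof. by rewrite /hits => /eqP<- /eqP/(quasigroupP _ hq)/esym. Qed.

Lemma cut_hits s z : hits h s z -> cut h z = free s.
Proof.
move=> hs; rewrite /cut /free !inE negb_or.
have key c : hits h c z = (s == c).
  by apply/idP/eqP => [/(hits_inj hs)|<-].
by rewrite !key.
Qed.

Lemma cut_balanced z i : #|[set s | cut h (upd z i s)]| = 2.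
Proof.
have [s1 h1] := hits_line_ex a z i; have [s2 h2] := hits_line_ex b z i.
have s12 : s1 != s2.
  by apply: contraNneq ab => e; rewrite e in h1; rewrite (hits_inj h1 h2).
have -> : [set s | cut h (upd z i s)] = ~: [set s1; s2].
  apply/setP => s; rewrite !inE /cut negb_or; congr (~~ _ && ~~ _).
    by apply/idP/eqP => [hs|-> //]; apply: hits_line_inj hs h1.
  by apply/idP/eqP => [hs|-> //]; apply: hits_line_inj hs h2.
by have := cardsC [set s1; s2]; rewrite cards2 s12 card_ord => -[].
Qed.

(** Each side of the cut is a union of two disjoint MDS codes, so a proper move along a line within
    one side must pass from one code to the other. *)
Lemma hits_flip s z i t :
  cut h z = free s -> cut h (upd z i t) = free s -> t != z i ->
  hits h s (upd z i t) = ~~ hits h s z.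
Proof.
move=> cz cz' tz; case: (boolP (hits h s z)) => [hz|nz] /=.
  apply: contra_neqF tz => ht.
  by move: hz; rewrite -{1}(upd_id z i) => hz; apply: hits_line_inj ht hz.
apply: contraT => nz'.
have [r hr] := hits_ex z; have [r' hr'] := hits_ex (upd z i t).
have e : r = r'.
  apply: (@balanced_third free s) free_balanced _ _ _ _.
  - by rewrite -cz (cut_hits hr).
  - by rewrite -cz' (cut_hits hr').
  - by apply: contraNneq nz => ->.
  - by apply: contraNneq nz' => ->.
case/eqP: tz; rewrite -e in hr'; apply: hits_line_inj hr' _.
by rewrite upd_id.
Qed.

Lemma hits_adj K s x y :
  cut h x = free s -> adj (cut h) K x y ->
  (x == y) || (hits h s y == ~~ hits h s x).
Proof.
move=> cx /adjP[cy [i [t [_ def]]]]; case: (eqVneq t (x i)) => [e|ne].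
  by rewrite def e upd_id eqxx.
by rewrite def hits_flip ?eqxx ?orbT // -def -cy.
Qed.

(* Along a path in a connected face, membership in each of the two MDS codes
   alternates, and parallel faces share the same paths. *)
Lemma hits_transfer K s s' x y w w' :
  face_conn (cut h) K w -> parallel (cut h) K w w' ->
  hits h s (mix K x w) -> hits h s (mix K y w) ->
  hits h s' (mix K x w') -> hits h s' (mix K y w').
Proof.
move=> /face_connP conn par hx hy hx'.
have cx := cut_hits hx; have cy := cut_hits hy; have cx' := cut_hits hx'.
have /conn c : cut h (mix K x w) = cut h (mix K y w) by rewrite cx.
pose P u := [/\ mix K u w = u, cut h u = free s &
               hits h s u = hits h s' (mix K u w')].
have : P (mix K y w).
  apply: (connect_invariant (P := P) _ c); last by split; rewrite ?mix_mixl ?hx ?hx'.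
  move=> u u' [fu cu eu] uu'; have [cuu' [i [t [iK def]]]] := adjP uu'.
  have fu' : mix K u' w = u' by rewrite def mix_face.
  split=> //; first by rewrite -cuu'.
  case: (eqVneq t (u i)) => [e|ne]; first by rewrite def e upd_id eu.
  have cw v : mix K v w = v -> cut h v = cut h u -> cut h (mix K v w') = free s'.
    move=> fv ev; move: (par v x); rewrite cx' cx fv ev cu addbb.
    by case: cut; case: free.
  rewrite def -upd_mix_in // !hits_flip ?eu //.
  - exact: cw.
  - by rewrite upd_mix_in // -def; apply: cw.
  - by rewrite ffunE iK.
  - by rewrite -def -cuu'.
by case=> _ _; rewrite mix_mixl => <-.
Qed.

Lemma reducible_of_face K :
  2 <= #|K| < n.+1 ->
  (forall v, face_conn (cut h) K v) -> (forall v w, parallel (cut h) K v w) ->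
  reducible h.
Proof.
move=> /andP[K2 Kn] conn par; case: (boolP (last \in K)) => lK; last first.
  apply: (@reducible_of_congruence _ _ K) => //; first by rewrite K2.
  move=> x y v v' e.
  pose w := upd v last (h (mix K x v)); pose w' := upd v' last (h (mix K x v')).
  have hm z (u : word n.+1) t :
      hits h (u last) (mix K z (upd u last t)) = (h (mix K z u) == t).
    by rewrite /hits -!upd_mix_notin // upd_upd upd_eq upd_mix_notin // upd_id.
  have := @hits_transfer K (v last) (v' last) x y w w' (conn _) (par _ _).
  by rewrite !hm e !eqxx => /(_ isT isT isT)/eqP.
apply: (@reducible_of_congruence _ _ (last |: ~: K)) => //.
  rewrite cardsU1 inE lK /=.
  have := cardsC K; rewrite card_ord => eK.
  rewrite add1n !ltnS -(ltn_add2l #|K|) addn0 eK Kn /=.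
  by rewrite -ltnS -[ltnRHS]eK -[#|_|.+1]add1n ltn_add2r.
move=> x y v v' e.
set J := last |: ~: K.
have hm (z u : word n.+1) t : hits h (z last) (mix K (upd u last t) z) = (h (mix J z u) == t).
  rewrite /hits -upd_mix_in // upd_upd upd_eq; congr (h _ == _).
  apply/ffunP => i; rewrite !ffunE !inE; case: eqP => [->//|_] /=.
  by case: (i \in K).
have := @hits_transfer K (x last) (y last) (upd v last (h (mix J x v)))
   (upd v' last (h (mix J x v'))) x y (conn _) (par _ _).
by rewrite !hm e !eqxx => /(_ isT isT isT)/eqP.
Qed.

End Fixed.

End Cut.

Lemma card_roots_bound (T : finType) (e : rel T) m :
  connect_sym e -> (forall x, m <= #|connect e x|) -> #|roots e| * m <= #|T|.
Proof.
move=> symc lb; rewrite -[leqRHS]sum1_card (partition_big (root e) (roots e)) /=; last first.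
  by move=> x _; apply: roots_root.
rewrite -sum_nat_const; apply: leq_sum => r rr.
apply: leq_trans (lb r) _; rewrite -[leqLHS]sum1_card; apply: eq_leq.
by apply: eq_bigl => x; rewrite [LHS]/in_mem /= -root_connect // (eqP rr) eq_sym.
Qed.

Section ComponentSize.

Variable n : nat.
Implicit Types (x y z v w : word n) (i j : 'I_n) (S T : {set 'I_n}).

Definition face S z : {set word n} := [set y | mix S y z == y].

Lemma face_refl S z : z \in face S z.
Proof. by rewrite inE mixxx. Qed.

Lemma face_out S z y j : y \in face S z -> j \notin S -> y j = z j.
Proof. by rewrite inE => /eqP/ffunP/(_ j); rewrite ffunE => <- /negPf->. Qed.

Lemma faceP S z y : (forall j, j \notin S -> y j = z j) -> y \in face S z.
Proof.
move=> H; rewrite inE; apply/eqP/ffunP => j; rewrite ffunE.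
by case: (boolP (j \in S)) => // /H.
Qed.

Lemma card_face_lower (C : {set word n}) S m :
  (forall z j, z \in C -> exists2 t, t != z j & upd z j t \in C) ->
  (forall z, z \in C -> m <= #|C :&: face S z|) ->
  forall T z, z \in C -> m * 2 ^ #|T :\: S| <= #|C :&: face (S :|: T) z|.
Proof.
move=> step base T; have [k] := ubnP #|T :\: S|.
elim: k T => // k IH T; rewrite ltnS => leT z zC.
case: (set_0Vmem (T :\: S)) => [e0|[j jT]].
  rewrite e0 cards0 muln1; apply: leq_trans (base z zC) _.
  apply: subset_leq_card; apply: setIS; apply/subsetP => y yf; apply: faceP => i.
  by rewrite inE negb_or => /andP[iS _]; apply: face_out yf iS.
have [jS jT'] : j \notin S /\ j \in T by apply/andP; rewrite -in_setD.
pose T' := T :\ j.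
have eT : T :\: S = j |: (T' :\: S).
  apply/setP => i; rewrite !inE; case: eqP => [->|] //=.
  by rewrite jT' jS.
have cT : #|T :\: S| = #|T' :\: S|.+1.
  by rewrite eT cardsU1 !inE eqxx /= andbF.
have [t tz tC] := step z j zC.
have lt' : #|T' :\: S| < k by rewrite -cT.
have sub y : y \in face (S :|: T) z ->
    C :&: face (S :|: T') y \subset C :&: face (S :|: T) z.
  move=> yf; apply: setIS; apply/subsetP => u uf; apply: faceP => i iST.
  rewrite (face_out uf) ?(face_out yf) //.
  by apply: contra iST; rewrite !inE => /orP[->//|/andP[_ ->]]; rewrite orbT.
have jout y u : u \in C :&: face (S :|: T') y -> u j = y j.
  by case/setIP=> _ uf; apply: face_out uf _; rewrite !inE eqxx /= (negPf jS).
have disj : [disjoint C :&: face (S :|: T') z & C :&: face (S :|: T') (upd z j t)].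
  apply/pred0P => u /=; apply/negP => /andP[/jout e1 /jout].
  by rewrite e1 upd_eq => e2; rewrite e2 eqxx in tz.
rewrite cT expnS mulnCA mul2n -addnn.
apply: leq_trans (leq_add (IH _ lt' _ zC) (IH _ lt' _ tC)) _.
move: disj; rewrite -leq_card_setU => /eqP <-; apply: subset_leq_card.
rewrite subUset !sub ?face_refl //; apply: faceP => i.
rewrite inE negb_or => /andP[_ iT]; rewrite upd_neq //.
by apply: contraNneq iT => ->.
Qed.

Variable chi : word n -> bool.
Hypothesis chi_bal : forall x i, #|[set s | chi (upd x i s)]| = 2.

Lemma card_plane_lower i j z b :
  i != j -> 8 <= #|[set y in face [set i; j] z | chi y == b]|.
Proof.
move=> ij; pose f (p : Sigma * Sigma) := upd (upd z i p.1) j p.2.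
have injf : injective f.
  move=> [s t] [s' t'] /ffunP e; congr pair.
    by have := e i; rewrite /f /= !(upd_neq _ _ ij) !upd_eq.
  by have := e j; rewrite /f /= !upd_eq.
have c8 : #|[set p | chi (f p) == b]| = 8.
  rewrite -sum1_card (eq_bigl (fun p => true && (chi (f p) == b))); last first.
    by move=> p; rewrite inE.
  rewrite -(pair_big_dep xpredT (fun s t => chi (f (s, t)) == b) (fun _ _ => 1)) /=.
  rewrite (eq_bigr (fun=> 2)) ?sum_nat_const ?card_ord // => s _.
  rewrite -[RHS](balanced_card b (chi_bal (upd z i s) j)) -sum1_card.
  by apply: eq_bigl => t; rewrite inE.
rewrite -[leqLHS]c8 -(card_imset _ injf); apply: subset_leq_card.
apply/subsetP => y /imsetP[p].
rewrite inE => cp ->; rewrite inE cp andbT; apply: faceP => k.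
by rewrite !inE negb_or => /andP[ki kj]; rewrite /f !upd_neq.
Qed.

Lemma card_component_lower (K : {set 'I_n}) x :
  2 <= #|K| -> (forall v, face_conn chi K v) ->
  2 ^ n.+1 <= #|connect (adj chi setT) x|.
Proof.
move=> /card_gt1P[i [j [iK jK ij]]] conn.
set C := [set y | connect (adj chi setT) x y].
have stepC z k : z \in C -> exists2 t, t != z k & upd z k t \in C.
  rewrite inE => cz.
  have /card_gt0P[t] : 0 < #|[set t | chi (upd z k t) == chi z] :\ z k|.
    have := cardsD1 (z k) [set t | chi (upd z k t) == chi z].
    by rewrite (balanced_card (chi z) (chi_bal z k)) !inE upd_id eqxx add1n => -[<-].
  rewrite !inE => /andP[tz /eqP et]; exists t => //; rewrite inE.
  by apply: connect_trans cz _; apply: connect1; apply: adj_upd; rewrite ?inE.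
have baseC z : z \in C -> 8 <= #|C :&: face [set i; j] z|.
  rewrite inE => cz; apply: leq_trans (card_plane_lower z (chi z) ij) _.
  apply: subset_leq_card; apply/subsetP => y; rewrite inE => /andP[yf /eqP ey].
  rewrite in_setI yf andbT inE.
  have fy : mix K y z = y.
    suff : y \in face K z by rewrite inE => /eqP.
    apply: faceP => k kK; apply: face_out yf _.
    by rewrite !inE; apply: contra kK => /orP[]/eqP->.
  apply: connect_trans cz _; apply: (adj_connect_sub (subsetT K)).
  by have /face_connP/(_ z y) := conn z; rewrite fy mixxx; apply.
have xC : x \in C by rewrite inE connect0.
have := card_face_lower stepC baseC [set: 'I_n] xC.
rewrite setTD; have := cardsC [set i; j]; rewrite cards2 ij card_ord => ec.
rewrite -(expnD 2 3) -[in n.+1]ec => H; apply: leq_trans H _.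
apply: subset_leq_card; apply/subsetP => y /setIP[].
by rewrite inE.
Qed.

End ComponentSize.

Section Additive.

Variable n : nat.
Implicit Types (x y z v w : word n) (F : 'I_n -> Sigma -> bool).

Definition xsum F z : bool := \big[addb/false]_(i < n) F i (z i).

Lemma xsum_upd F z i s : xsum F (upd z i s) = F i s (+) F i (z i) (+) xsum F z.
Proof.
rewrite /xsum (bigD1 i) //= upd_eq [in RHS](bigD1 i) //=.
rewrite (eq_bigr (fun j => F j (z j))); last by move=> j ji; rewrite upd_neq.
by case: (F i s); case: (F i (z i)); case: (\big[_/_]_(_ < _ | _) _).
Qed.

Lemma xsum_balanced F :
  (forall i, #|[set s | F i s]| = 2) -> forall z i, #|[set s | xsum F (upd z i s)]| = 2.
Proof.
move=> Fb z i; rewrite -[RHS](balanced_card (~~ (xsum F z (+) F i (z i))) (Fb i)).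
apply: eq_card => s; rewrite !inE xsum_upd.
by case: (F i s); case: (F i (z i)); case: xsum.
Qed.

Lemma balanced_xsum F :
  (forall z i, #|[set s | xsum F (upd z i s)]| = 2) -> forall i, #|[set s | F i s]| = 2.
Proof.
move=> Fb i; pose z : word n := [ffun=> ord0].
rewrite -[RHS](balanced_card (~~ (xsum F z (+) F i (z i))) (Fb z i)).
apply: eq_card => s; rewrite !inE xsum_upd.
by case: (F i s); case: (F i (z i)); case: xsum.
Qed.

Lemma xsum_of_parallel (chi : word n -> bool) z0 :
  chi z0 = false -> (forall i v w, parallel chi [set i] v w) ->
  exists F, forall z, chi z = xsum F z.
Proof.
move=> chi0 par; exists (fun i s => chi (upd z0 i s)).
apply: (@word_upd_ind _ _ z0) => [w i s IH|]; last first.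
  by rewrite chi0 /xsum big1 // => i _; rewrite upd_id.
rewrite xsum_upd -IH.
have := par i w z0 (upd w i s) w; rewrite !mix_set1 upd_eq upd_id.
by do 4 case: (chi _).
Qed.

Lemma card_lineI (C : {set word n}) i y :
  #|line i y :&: C| = #|[set s | upd y i s \in C]|.
Proof.
rewrite -(card_imset _ (@upd_inj _ y i)); apply: eq_card => z.
apply/setIP/imsetP => [[]|[s]].
  rewrite inE => /forallP zy zC; exists (z i).
    rewrite inE (_ : upd y i (z i) = z) //.
    apply/ffunP => j; rewrite ffunE; case: eqP => [->//|/eqP ji].
    by rewrite -(eqP (implyP (zy j) ji)).
  apply/ffunP => j; rewrite ffunE; case: eqP => [->//|/eqP ji].
  by rewrite -(eqP (implyP (zy j) ji)).
rewrite inE => yC ->; split=> //; rewrite inE; apply/forallP => j.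
by apply/implyP => ji; rewrite upd_neq.
Qed.

End Additive.

Lemma widen_ord_lift m (k : 'I_m) : widen_ord (leqnSn m) k = lift ord_max k.
Proof. by apply: val_inj; rewrite [RHS]lift_max. Qed.

Section Counting.

Variables (n : nat) (a b : Sigma) (h : word n.+1 -> Sigma).
Hypothesis ab : a != b.
Hypothesis hq : is_quasigroup h.

Let last := @ord_max n.
Let chi := cut a b h.
Let chi_bal := cut_balanced ab hq.

Lemma QsetP (f : {ffun word n.+1 -> Sigma}) :
  reflect (is_quasigroup f /\ forall x : word n.+1, ~~ free a b (x last) -> f x = h x)
          (f \in Qset h a b).
Proof.
rewrite inE; apply: (iffP andP) => -[fq H]; split=> //.
  move=> x; rewrite negbK => xl; apply/eqP/(implyP (forallP H x)).
  by apply/existsP; exists last; rewrite eqxx.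
apply/forallP => x; apply/implyP => /existsP[i /andP[/eqP[ei] xi]]; apply/eqP/H.
by rewrite negbK (_ : last = i) //; apply: val_inj.
Qed.

Lemma cut_Qset (f : {ffun word n.+1 -> Sigma}) :
  f \in Qset h a b -> cut a b f =1 chi.
Proof.
case/QsetP=> _ H z; rewrite /chi /cut /hits !H // upd_eq negbK !inE eqxx ?orbT //.
Qed.

Lemma card_Qset_components :
  #|Qset h a b| <= 2 ^ #|[set r | roots (adj chi setT) r & chi r]|.
Proof.
have [c fc] := balanced_ex true (free_balanced ab).
pose e := adj chi [set: 'I_n.+1].
have symc : connect_sym e by apply: adj_connect_sym.
pose D (f : {ffun word n.+1 -> Sigma}) z := hits f c z (+) hits h c z.
have inv f z : f \in Qset h a b -> chi z -> D f z = D f (root e z).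
  move=> fQ cz; have [fq _] := QsetP _ fQ.
  pose P u := chi u /\ D f z = D f u.
  suff [] : P (root e z) by [].
  apply: (connect_invariant _ (connect_root e z)) => // u v [cu eu] uv.
  have [cuv _] := adjP uv; rewrite /P -cuv; split=> //; rewrite eu /D.
  have fcu : cut a b f u = free a b c by rewrite cut_Qset // cu fc.
  have uv' : adj (cut a b f) setT u v.
    by move: uv; rewrite /e /adj !cut_Qset.
  have hcu : cut a b h u = free a b c by rewrite fc.
  have := hits_adj ab fq fcu uv'; have := hits_adj ab hq hcu uv.
  case: (eqVneq u v) => [->//|_] /= /eqP-> /eqP->.
  by rewrite addNb addbN negbK.
pose Phi f := [set r | [&& roots e r, chi r & D f r]].
have injPhi : {in Qset h a b &, injective Phi}.
  move=> f g fQ gQ ePhi; have [fq fh] := QsetP _ fQ; have [gq gh] := QsetP _ gQ.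
  have same z : chi z -> hits f c z = hits g c z.
    move=> cz; have : D f z = D g z.
      rewrite (inv f z) // (inv g z) //; have /setP/(_ (root e z)) := ePhi.
      by rewrite !inE roots_root //= -(connect_chi (connect_root e z)) cz.
    by rewrite /D; do 3 case: hits.
  apply/ffunP => x; case: (boolP (free a b (x last))) => [xl|/[dup] xl /fh->]; last first.
    by rewrite gh.
  pose z := upd x last (f x).
  have hz : hits f (x last) z by have := hits_upd_last f (x last) x; rewrite upd_id.
  have cz : chi z by rewrite -(cut_Qset fQ) (cut_hits a b fq hz).
  have [s hs] := hits_ex gq z.
  have fs : free a b s by rewrite -(cut_hits a b gq hs) cut_Qset.
  suff : s = x last.
    by move: hs => /[swap] ->; rewrite /hits upd_upd upd_id upd_eq => /eqP.
  case: (eqVneq (x last) c) => [xc|xc].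
    by apply: hits_inj hs _ => //; rewrite xc -same // -xc.
  apply: (@balanced_third (free a b) c) (free_balanced ab) _ _ _ _; rewrite ?fc //.
    apply/eqP => sc; have hc := hits_inj fq hz; move: hs; rewrite -sc -same //.
    by move/hc/eqP; rewrite (negPf xc).
  by rewrite eq_sym.
rewrite -(card_in_imset injPhi) -card_powerset; apply: subset_leq_card.
apply/subsetP => A /imsetP[f _ ->]; rewrite powersetE; apply/subsetP => r.
by rewrite !inE => /and3P[-> ->].
Qed.

Lemma card_Qset_connected v : face_conn chi setT v -> #|Qset h a b| <= 2.
Proof.
move=> /face_connP conn; apply: leq_trans card_Qset_components _.
rewrite -[leqRHS]/(2 ^ 1) leq_exp2l //; apply/card_le1_eqP => r s.
rewrite !inE => /andP[/eqP rr cr] /andP[/eqP rs cs].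
have := conn r s; rewrite !mix_setT cr cs => /(_ erefl).
by rewrite -root_connect ?rr ?rs => [/eqP|]; last exact: adj_connect_sym.
Qed.

Lemma card_Qset_face (K : {set 'I_n.+1}) :
  2 <= #|K| -> (forall v, face_conn chi K v) -> #|Qset h a b| < 2 ^ (2 ^ n).
Proof.
move=> K2 conn; apply: leq_ltn_trans card_Qset_components _; rewrite ltn_exp2l //.
pose e := adj chi [set: 'I_n.+1].
have symc : connect_sym e by apply: adj_connect_sym.
have lb := card_roots_bound symc (fun x => card_component_lower chi_bal x K2 conn).
have le2 : #|roots e| <= 2 ^ n.
  move: lb; rewrite card_ffun !card_ord -[4]/(2 ^ 2) -expnM.
  have -> : 2 * n.+1 = n + n.+2 by rewrite mul2n -addnn addSnnS.
  by rewrite expnD leq_pmul2r // expn_gt0.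
apply: leq_trans le2; apply: proper_card; apply/properP; split.
  by apply/subsetP => r; rewrite inE => /andP[].
pose z0 : word n.+1 := [ffun=> ord0].
have [s cs] := balanced_ex false (chi_bal z0 last).
exists (root e (upd z0 last s)); first exact: roots_root.
by rewrite inE -(connect_chi (connect_root e _)) /chi cs andbF.
Qed.

Lemma card_Qset_xsum (F : 'I_n.+1 -> Sigma -> bool) :
  (forall z, chi z = xsum F z) -> 2 ^ (2 ^ n) <= #|Qset h a b|.
Proof.
move=> chiF.
have Fbal : forall i, #|[set s | F i s]| = 2.
  apply: balanced_xsum => z i; rewrite -[RHS](chi_bal z i); apply: eq_card => s.
  by rewrite !inE -chiF.
have [c fc] := balanced_ex true (free_balanced ab).
have /card_gt0P[d] : 0 < #|[set s | free a b s] :\ c|.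
  by have := cardsD1 c [set s | free a b s]; rewrite (free_balanced ab) inE fc add1n => -[<-].
rewrite !inE => /andP[dc fd].
pose swap s := if s == c then d else if s == d then c else s.
have swapK : involutive swap.
  move=> s; rewrite /swap; case: (eqVneq s c) => [->|sc]; first by rewrite (negPf dc) eqxx.
  case: (eqVneq s d) => [->|sd]; first by rewrite eqxx.
  by rewrite (negPf sc) (negPf sd).
have swap_free s : free a b (swap s) = free a b s.
  by rewrite /swap; case: eqP => [->|_]; [rewrite fc fd|case: eqP => [->|]; rewrite ?fc ?fd].
have swap_id s : ~~ free a b s -> swap s = s.
  by rewrite /swap => ns; case: eqP ns => [->|_]; [rewrite fc|case: eqP => [->|]; rewrite ?fd].
pose eps (x : word n.+1) : {ffun 'I_n -> bool} :=
  [ffun i => F (lift last i) (x (lift last i))].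
pose tw (s : {ffun {ffun 'I_n -> bool} -> bool}) x t := if s (eps x) then swap t else t.
have tw_inj s x : injective (tw s x).
  by rewrite /tw; case: (s _) => //; apply: can_inj swapK.
have tw_free s x t : free a b (tw s x t) = free a b t.
  by rewrite /tw; case: (s _).
have eps_last x t : eps (upd x last t) = eps x.
  by apply/ffunP => i; rewrite !ffunE eq_sym (negPf (neq_lift _ _)).
pose f s : {ffun word n.+1 -> Sigma} :=
  [ffun x : word n.+1 => h (upd x last (tw s x (x last)))].
have hqP := quasigroupP _ hq.
have fQ s : f s \in Qset h a b.
  apply/QsetP; split; last first.
    by move=> x nx; rewrite ffunE /tw swap_id // if_same upd_id.
  apply/quasigroupP => i x t r.
  rewrite [LHS]ffunE [RHS]ffunE; case: (eqVneq i last) => [->|il].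
    by rewrite /tw !eps_last !upd_upd !upd_eq => /hqP/(tw_inj s x).
  rewrite !(@upd_neq _ x i last) 1?[last == i]eq_sym // => e.
  have [nx|fx] := boolP (~~ free a b (x last)).
    move: e; rewrite /tw !swap_id // !if_same.
    by rewrite !(updC _ _ _ il) upd_id => /hqP.
  rewrite negbK in fx.
  pose y := h (upd (upd x i t) last (tw s (upd x i t) (x last))).
  have cut1 u : h (upd (upd x i u) last (tw s (upd x i u) (x last))) = y ->
      chi (upd (upd x last y) i u).
    move=> ey; have := hits_upd_last h (tw s (upd x i u) (x last)) (upd x i u).
    by rewrite ey => /(cut_hits a b hq); rewrite -(updC x u y il) /chi => ->; rewrite tw_free.
  have := cut1 t erefl; have := cut1 r (esym e).
  rewrite !chiF !(xsum_upd F (upd x last y) i) => c1 c2.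
  have eF : F i t = F i r.
    by move: c1 c2; case: (F i t); case: (F i r); case: xsum; case: (F i _).
  have eeps : eps (upd x i t) = eps (upd x i r).
    by apply/ffunP => k; rewrite !ffunE; case: eqP => // ->.
  by move: e; rewrite /tw eeps !(updC _ _ _ il) => /hqP.
have f_inj : injective f.
  move=> s s' ess; apply/ffunP => ep.
  have [g gP] := fin_all_exists (fun i : 'I_n => balanced_ex (ep i) (Fbal (lift last i))).
  pose x : word n.+1 := [ffun j => if unlift last j is Some i then g i else c].
  have xe : eps x = ep by apply/ffunP => i; rewrite !ffunE liftK gP.
  have xl : x last = c by rewrite ffunE unlift_none.
  have /ffunP/(_ x) := ess; rewrite [LHS]ffunE [RHS]ffunE => /hqP; rewrite /tw xe xl /swap eqxx.
  by case: (s ep); case: (s' ep) => // e; rewrite e eqxx in dc.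
have <- : #|f @: [set: {ffun {ffun 'I_n -> bool} -> bool}]| = 2 ^ (2 ^ n).
  by rewrite card_imset // cardsT !card_ffun !card_bool card_ord.
by apply: subset_leq_card; apply/subsetP => _ /imsetP[s _ ->].
Qed.

Lemma graph_MDS : MDS_code (graph h).
Proof.
move=> i y; rewrite card_lineI; apply/eqP/cards1P.
pose r (y : word n.+2) : word n.+1 := [ffun i => y (widen_ord (leqnSn n.+1) i)].
case: (unliftP ord_max i) => [k ->|->].
  have rk s : r (upd y (lift ord_max k) s) = upd (r y) k s.
    by apply/ffunP => q; rewrite !ffunE widen_ord_lift (inj_eq lift_inj).
  have [t et] := quasigroup_solve k (r y) (y ord_max) hq.
  exists t; apply/setP => s; rewrite !inE upd_neq ?neq_lift // -/(r _) rk -et.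
  by apply/eqP/eqP => [/(quasigroupP _ hq)|->].
exists (h (r y)); apply/setP => s; rewrite !inE upd_eq -/(r _).
congr (_ == h _); apply/ffunP => q; rewrite !ffunE widen_ord_lift.
by rewrite eq_sym (negPf (neq_lift _ _)).
Qed.

Lemma semilinear_of_xsum (F : 'I_n.+1 -> Sigma -> bool) :
  (forall z, chi z = xsum F z) -> semilinear_qg h.
Proof.
move=> chiF; split; first exact: graph_MDS.
have Fbal : forall i, #|[set s | F i s]| = 2.
  apply: balanced_xsum => z i; rewrite -[RHS](chi_bal z i); apply: eq_card => s.
  by rewrite !inE -chiF.
have fixed_bal : #|[set s | ~~ free a b s]| = 2.
  rewrite -[RHS](balanced_card false (free_balanced ab)); apply: eq_card => s.
  by rewrite !inE eqbF_neg.
pose G (j : 'I_n.+2) : Sigma -> bool :=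
  if unlift ord_max j is Some i then
    if i == last then fun s => ~~ free a b s else F i
  else F last.
exists [set y | xsum G y]; split; first split.
- move=> i y; rewrite card_lineI.
  rewrite -[RHS](@xsum_balanced _ G _ y i); first by apply: eq_card => s; rewrite !inE.
  by move=> j; rewrite /G; case: unlift => [k|]; first case: ifP.
- by exists G => y; rewrite inE.
apply/subsetP => y; rewrite !inE; set x := [ffun _ => _] => /eqP ey.
rewrite /xsum big_ord_recr /= {2}/G unlift_none ey.
have hx : hits h (x last) (upd x last (h x)).
  by have := hits_upd_last h (x last) x; rewrite upd_id.
have := cut_hits a b hq hx; rewrite -/chi chiF /xsum (bigD1 last) //= upd_eq => ec.
rewrite (bigD1 last) //= widen_ord_lift {1}/G liftK eqxx.
rewrite (eq_bigr (fun i => F i (upd x last (h x) i))); last first.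
  by move=> i il; rewrite widen_ord_lift /G liftK (negPf il) upd_neq // ffunE widen_ord_lift.
have -> : y (lift ord_max last) = x last by rewrite ffunE widen_ord_lift.
by rewrite -ec; case: (F _ _); case: (\big[_/_]_(_ < _ | _) _).
Qed.

End Counting.

Theorem theorem5 (n : nat) (hn : 0 < n) (h : word n -> Sigma) (a b : Sigma) :
  is_quasigroup h -> a != b ->
  ((2 < #|Qset h a b| < 2 ^ (2 ^ n.-1))%N -> reducible h) /\
  (#|Qset h a b| = 2 ^ (2 ^ n.-1) -> semilinear_qg h).
Proof.
case: n hn h => // n _ h hq ab /=.
pose chi := cut a b h; have chi_bal := cut_balanced ab hq.
pose z0 : word n.+1 := [ffun=> ord0].
pose P (K : {set 'I_n.+1}) := (K != set0) && [exists v, face_conn chi K v].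
have P1 i : P [set i].
  apply/andP; split; first by apply/set0Pn; exists i; rewrite inE.
  by apply/existsP; exists z0; apply: face_conn_set1.
have [K /andP[K0 /existsP[v0 conn0]] maxK] :=
  arg_maxnP (fun K : {set 'I_n.+1} => #|K|) (P1 ord_max).
have {}maxK S v : face_conn chi S v -> #|S| <= #|K|.
  case: (eqVneq S set0) => [->|S0 cS]; first by rewrite cards0.
  by apply: maxK; rewrite /P S0; apply/existsP; exists v.
have [K2|K1] := leqP 2 #|K|.
  have H := maximal_face_conn chi_bal K0 conn0 maxK.
  have conn v : face_conn chi K v by case: (H v).
  have par v w : parallel chi K v w.
    by move=> x y; have [_ <-] := H v; have [_ <-] := H w.
  split; last by move=> eQ; have := card_Qset_face ab hq K2 conn; rewrite eQ ltnn.
  case/andP=> Q2 _; apply: (reducible_of_face ab hq _ conn par); rewrite K2 /=.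
  have := max_card K; rewrite card_ord ltn_neqAle => ->; rewrite andbT.
  apply: contraL Q2 => /eqP cK; rewrite -leqNgt.
  have KT : K = setT by apply/eqP; rewrite eqEcard subsetT cardsT card_ord cK /=.
  by apply: (@card_Qset_connected _ _ _ _ ab hq z0); rewrite -KT.
have par i v w : parallel chi [set i] v w.
  have max1 S u : face_conn chi S u -> #|S| <= #|[set i]|.
    by move/maxK => SK; rewrite cards1; apply: leq_trans SK _.
  have i0 : [set i] != set0 by case/andP: (P1 i).
  by have [_] := maximal_face_conn chi_bal i0 (face_conn_set1 chi i v) max1 w.
have [s cs] := balanced_ex false (chi_bal z0 ord_max).
have [F chiF] := xsum_of_parallel cs par.
split; last by move=> _; apply: semilinear_of_xsum chiF.
by case/andP=> _; rewrite ltnNge (card_Qset_xsum ab hq chiF).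
Qed.
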